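(* Let $P$ be a (possibly disjunctive) range-restricted logic program with negation and let $S_P$ be the set of predicate symbols occurring in $P$. Then $\{M[S_P]\mid M\in\mathcal{SM}(P)\}=\{M[S_P]\mid M\in\mathcal{SM}(ext(P))\}$.
   Context: A rule has the form $A_1\vee\dots\vee A_m\leftarrow B_1,\dots,B_k,\neg C_1,\dots,\neg C_n$ ($m>0$, atoms built from constants, variables, function symbols); $head(r)$ is the disjunction, $body(r)$ the body, $body^+(r)=B_1,\dots,B_k$. A program is a finite set of rules; predicates are base (defined only by facts) or derived; range-restricted: variables in the head or negative body occur in the positive body. $\mathcal{SM}(P)$ is the set of stable models (Gelfond–Lifschitz): for a set $I$ of ground atoms, $P^I$ is obtained from the ground instantiation of $P$ by deleting rules with some $\neg A$ in the body with $A\in I$ and deleting negative literals from the rest; $I$ is stable iff it is a minimal model of $P^I$. For a set of ground atoms $M$ and set of predicate symbols $S$, $M[S]$ is the set of atoms of $M$ whose predicate is in $S$. $st(P)$ replaces each rule $a_1\vee\dots\vee a_m\leftarrow body(r)$ by the rules $a_i\leftarrow body^+(r)$, $1\le i\le m$. $ST(P)$ is obtained from $st(P)$ by replacing every derived predicate symbol $q$ with a fresh predicate symbol $Q$. For a rule $r=q_1(u_1)\vee\dots\vee q_k(u_k)\leftarrow body(r)$, $headconj(r)$ is the conjunction $Q_1(u_1),\dots,Q_k(u_k)$, and $ext(r)$ is the rule $head(r)\leftarrow headconj(r),body(r)$. The extended program is $ext(P)=\{ext(r)\mid r\in P\}\cup ST(P)$. *)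

(* Defs.v *)
From Stdlib Require List.
From mathcomp Require Import all_boot.
From mathcomp Require Import boolp classical_sets cardinality.

Set Implicit Arguments.
Unset Strict Implicit.
Unset Printing Implicit Defensive.

Local Open Scope classical_set_scope.

(* Symbols are graded by their arity; a constant is a function symbol of
   arity 0.  [default_const] is only used to keep the Herbrand universe of a
   program without constants nonempty. *)
Record signature := Signature {
  fsym : nat -> Type;
  psym : nat -> Type;
  default_const : fsym 0
}.

Inductive term (sg : signature) (V : Type) : Type :=
| Var of V
| App n of fsym sg n & ('I_n -> term sg V).

Record atom (sg : signature) (V : Type) : Type := Atom {
  arity : nat;
  psym_of : psym sg arity;
  args : 'I_arity -> term sg V
}.
Arguments args {sg V} a i.

Definition fname (sg : signature) := {n : nat & fsym sg n}.
Definition pname (sg : signature) := {n : nat & psym sg n}.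

Definition pred_of sg V (a : atom sg V) : pname sg := existT _ _ (psym_of a).

(* A_1 \/ ... \/ A_m <- B_1, ..., B_k, ~ C_1, ..., ~ C_n *)
Record rule (sg : signature) (V : Type) : Type := Rule {
  head : seq (atom sg V);
  pbody : seq (atom sg V);
  nbody : seq (atom sg V)
}.

Notation gterm sg := (term sg void).
Notation gatom sg := (atom sg void).
Notation grule sg := (rule sg void).

Notation prule sg := (rule sg nat).

Section Syntax.
Variable sg : signature.
Implicit Types (P : set (prule sg)) (r : prule sg).

Definition atoms_of V (r : rule sg V) : seq (atom sg V) :=
  head r ++ pbody r ++ nbody r.

Fixpoint var_in_term V (x : V) (t : term sg V) : Prop :=
  match t with
  | Var y => y = x
  | App _ _ ts => exists i, var_in_term x (ts i)
  end.

Definition var_in V (x : V) (a : atom sg V) : Prop :=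
  exists i, var_in_term x (args a i).

Fixpoint fsym_in_term V (s : fname sg) (t : term sg V) : Prop :=
  match t with
  | Var _ => False
  | App n f ts => existT _ n f = s \/ exists i, fsym_in_term s (ts i)
  end.

Definition fsym_in V (s : fname sg) (a : atom sg V) : Prop :=
  exists i, fsym_in_term s (args a i).

Definition fsyms P : set (fname sg) :=
  [set s | exists r a, [/\ P r, List.In a (atoms_of r) & fsym_in s a]].

Definition preds P : set (pname sg) :=
  [set s | exists r a, [/\ P r, List.In a (atoms_of r) & pred_of a = s]].

Definition is_program P : Prop :=
  finite_set P /\ forall r, P r -> head r <> [::].

Definition range_restricted P : Prop :=
  forall r, P r -> forall a, List.In a (head r ++ nbody r) ->
  forall x, var_in x a -> exists2 b, List.In b (pbody r) & var_in x b.

(* Facts have a single head atom; under range restriction they are ground. *)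
Definition is_fact r : Prop :=
  exists a, r = Rule [:: a] [::] [::].

(* [base] splits the predicates into base and derived (= not base) ones. *)
Definition base_defined_by_facts (base : set (pname sg)) P : Prop :=
  forall r, P r -> forall a, List.In a (head r) -> base (pred_of a) ->
  is_fact r.

End Syntax.

Section Semantics.
Variable sg : signature.
Implicit Types (P : set (prule sg)) (G : set (grule sg)) (I M N : set (gatom sg)).

Inductive herbrand_universe P : set (gterm sg) :=
| HU_app n (f : fsym sg n) (ts : 'I_n -> gterm sg) :
    fsyms P (existT _ n f) -> (forall i, herbrand_universe P (ts i)) ->
    herbrand_universe P (App f ts)
| HU_default (ts : 'I_0 -> gterm sg) :
    (forall c : fsym sg 0, ~ fsyms P (existT _ 0 c)) ->
    herbrand_universe P (App (default_const sg) ts).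

Fixpoint subst_term V W (s : V -> term sg W) (t : term sg V) : term sg W :=
  match t with
  | Var x => s x
  | App _ f ts => App f (fun i => subst_term s (ts i))
  end.

Definition subst_atom V W (s : V -> term sg W) (a : atom sg V) : atom sg W :=
  Atom (psym_of a) (fun i => subst_term s (args a i)).

Definition subst_rule V W (s : V -> term sg W) (r : rule sg V) : rule sg W :=
  Rule (map (subst_atom s) (head r)) (map (subst_atom s) (pbody r))
       (map (subst_atom s) (nbody r)).

Definition ground P : set (grule sg) :=
  [set g | exists r (s : nat -> gterm sg),
     [/\ P r, forall x, herbrand_universe P (s x) & g = subst_rule s r]].

Definition reduct G I : set (grule sg) :=
  [set Rule (head g) (pbody g) [::] | g in
     [set g | G g /\ forall a, List.In a (nbody g) -> ~ I a]].

Definition model G M : Prop :=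
  forall g, G g ->
  (forall a, List.In a (pbody g) -> M a) ->
  (forall a, List.In a (nbody g) -> ~ M a) ->
  exists2 a, List.In a (head g) & M a.

Definition minimal_model G M : Prop :=
  model G M /\ forall N, N `<=` M -> model G N -> N = M.

Definition SM P : set (set (gatom sg)) :=
  [set I | minimal_model (reduct (ground P) I) I].

(* M[S] *)
Definition restrict_preds M (S : set (pname sg)) : set (gatom sg) :=
  [set a | M a /\ S (pred_of a)].

End Semantics.

Section Extension.
Variables (sg : signature) (base : set (pname sg)).
(* [Q] maps a derived predicate symbol q to its copy of the same arity; its
   values on base predicates are not used. *)
Variable Q : forall n, psym sg n -> psym sg n.
Implicit Types (P : set (prule sg)) (r : prule sg).

(* Symbols of different arities are distinct by construction, so injectivity
   only has to be required arity by arity. *)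
Definition fresh_renaming P : Prop :=
  (forall n (q : psym sg n), preds P (existT _ n q) -> ~ base (existT _ n q) ->
     ~ preds P (existT _ n (Q q))) /\
  (forall n (q q' : psym sg n),
     preds P (existT _ n q) -> ~ base (existT _ n q) ->
     preds P (existT _ n q') -> ~ base (existT _ n q') ->
     Q q = Q q' -> q = q').

Definition rename_atom V (a : atom sg V) : atom sg V :=
  if `[< base (pred_of a) >] then a else Atom (Q (psym_of a)) (args a).

Definition rename_rule V (r : rule sg V) : rule sg V :=
  Rule (map (@rename_atom V) (head r)) (map (@rename_atom V) (pbody r))
       (map (@rename_atom V) (nbody r)).

Definition st P : set (prule sg) :=
  [set r' | exists r a,
     [/\ P r, List.In a (head r) & r' = Rule [:: a] (pbody r) [::]]].

Definition ST P : set (prule sg) := [set rename_rule r | r in st P].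

Definition headconj r : seq (atom sg nat) := map (@rename_atom nat) (head r).

Definition ext_rule r : prule sg :=
  Rule (head r) (headconj r ++ pbody r) (nbody r).

Definition ext P : set (prule sg) := [set ext_rule r | r in P] `|` ST P.

End Extension.

(* Main.v *)
From Stdlib Require List Eqdep_dec.
From mathcomp Require Import all_boot.
From mathcomp Require Import boolp classical_sets cardinality.
Require Import Defs.

(** Let L be the least model of the ground instantiation of st(P), and for a
    set N of atoms of P let N' be the union of N and the renamed copy of L.
    The rules of ST(P) force the copy of L into every model of a reduct of
    ext(P), so [headconj] holds as soon as the positive body of a rule lies in
    L.  Hence, for N included in L, N is a model of the reduct of P iff N' is a
    model of the reduct of ext(P).  Intersecting a model of either reduct with L
    yields a model of the reduct of P; by minimality the stable models of P are
    included in L, those of ext(P) are the sets N', and N |-> N' matches them. *)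

Set Implicit Arguments.
Unset Strict Implicit.
Unset Printing Implicit Defensive.

Local Open Scope classical_set_scope.

(** * Reducts, Herbrand universes and restriction to predicates *)

Lemma model_reduct sg (G : set (grule sg)) (I M : set (gatom sg)) :
  model (reduct G I) M <->
  forall g, G g -> (forall a, List.In a (pbody g) -> M a) ->
  (forall a, List.In a (nbody g) -> ~ I a) ->
  exists2 a, List.In a (head g) & M a.
Proof.
split=> [mM g Gg gp gn | mM _ [g [Gg gn] <-] gp _]; last exact: mM g Gg gp gn.
by apply: (mM (Rule (head g) (pbody g) [::])) => //; exists g.
Qed.

(** Inclusion of the symbol sets would not suffice: the default constant belongs to the universe
    only when the program has no constant, so a new constant could remove it. *)
Lemma herbrand_universe_mono sg (P P' : set (prule sg)) :
  (forall s, fsyms P s <-> fsyms P' s) ->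
  herbrand_universe P `<=` herbrand_universe P'.
Proof.
move=> eqf t; elim=> [n f ts Pf _ IH | ts noc].
  by apply: HU_app => //; apply/eqf.
by apply: HU_default => c /eqf /noc.
Qed.

Lemma restrict_preds_id sg (M : set (gatom sg)) (S : set (pname sg)) :
  (forall a, M a -> S (pred_of a)) -> restrict_preds M S = M.
Proof. by move=> MS; apply/seteqP; split=> [a [] //|a Ma]; split; auto. Qed.

(** The set L. It is built on [ground P] because [st P] drops negative bodies, hence may have fewer
    function symbols and another Herbrand universe. *)
Inductive derivable sg (P : set (prule sg)) : set (gatom sg) :=
| Derivable g a : ground P g -> List.In a (head g) ->
    (forall b, List.In b (pbody g) -> derivable P b) -> derivable P a.

(** * Derivable atoms and models of the reducts of [P] *)

Section Derivable.
Variables (sg : signature) (P : set (prule sg)).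
Implicit Types (g : grule sg) (a : gatom sg) (I M : set (gatom sg)).

Lemma ground_preds g a :
  ground P g -> List.In a (atoms_of g) -> preds P (pred_of a).
Proof.
move=> [r [s [Pr _ ->]]]; rewrite /atoms_of /= -!map_cat => /List.in_map_iff.
by move=> [b [<- rb]]; exists r, b.
Qed.

Lemma ground_head_preds g a :
  ground P g -> List.In a (head g) -> preds P (pred_of a).
Proof.
by move=> Pg ga; apply: (ground_preds Pg); apply/List.in_app_iff; left.
Qed.

Lemma ground_pbody_preds g a :
  ground P g -> List.In a (pbody g) -> preds P (pred_of a).
Proof.
move=> Pg ga; apply: (ground_preds Pg); rewrite /atoms_of !List.in_app_iff.
by right; left.
Qed.

Lemma ground_nbody_preds g a :
  ground P g -> List.In a (nbody g) -> preds P (pred_of a).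
Proof.
move=> Pg ga; apply: (ground_preds Pg); rewrite /atoms_of !List.in_app_iff.
by right; right.
Qed.

Lemma derivable_preds a : derivable P a -> preds P (pred_of a).
Proof. by case=> g {}a Pg /(ground_head_preds Pg). Qed.

(** When a positive body is derivable, so is every head atom, in particular the one that [M]
    satisfies. *)
Lemma model_setI_derivable I M :
  model (reduct (ground P) I) M ->
  model (reduct (ground P) I) (M `&` derivable P).
Proof.
move=> /model_reduct mM; apply/model_reduct => g Pg gp gn.
have [a ga Ma] := mM g Pg (fun b gb => (gp b gb).1) gn.
by exists a => //; split=> //; apply: (Derivable Pg ga) => b /gp[].
Qed.

Lemma SM_derivable M : SM P M -> M `<=` derivable P.
Proof.
move=> [/model_setI_derivable mM minM].
by rewrite -(minM _ _ mM) => [a []|a []].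
Qed.

(** The last rule of a derivation of a base atom is a fact; its bodies are empty, so it survives in
    every reduct and forces its only head atom. *)
Lemma derivable_base base I M a : base_defined_by_facts base P ->
  model (reduct (ground P) I) M -> base (pred_of a) -> derivable P a -> M a.
Proof.
move=> facts /model_reduct mM ba da; case: da ba => g {}a Pg ga _ ba.
have [r [s [Pr _ def_g]]] := Pg.
move: (ga); rewrite {1}def_g /= => /List.in_map_iff [c [def_a rc]].
have bc : base (pred_of c) by rewrite -def_a in ba.
have [d def_r] := facts r Pr c rc bc.
have [] := mM g Pg; rewrite ?def_g ?def_r //= => b [<- Mb | //].
by move: ga; rewrite def_g def_r /= => -[<- | //].
Qed.

End Derivable.

(** * Ground instances and reduct models of the extended program *)

Section Extension.
Variables (sg : signature) (P : set (prule sg)) (base : set (pname sg)).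
Variable Q : forall n : nat, psym sg n -> psym sg n.
Implicit Types (g : grule sg) (I J K M N : set (gatom sg)).

Local Notation ren := (@rename_atom _ base Q _).
Local Notation L := (derivable P).

Lemma rename_base V (a : atom sg V) : base (pred_of a) -> ren a = a.
Proof. by rewrite /rename_atom; case: asboolP. Qed.

Lemma rename_derived V (a : atom sg V) : ~ base (pred_of a) ->
  ren a = Atom (Q (psym_of a)) (args a).
Proof. by rewrite /rename_atom; case: asboolP. Qed.

Lemma rename_subst V W (s : V -> term sg W) (a : atom sg V) :
  ren (subst_atom s a) = subst_atom s (ren a).
Proof.
by rewrite /rename_atom -[pred_of (subst_atom s a)]/(pred_of a); case: asboolP.
Qed.

Lemma map_rename_subst V W (s : V -> term sg W) (t : seq (atom sg V)) :
  map ren (map (subst_atom s) t) = map (subst_atom s) (map ren t).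
Proof. by rewrite -!map_comp; apply: eq_map => a /=; apply: rename_subst. Qed.

Lemma fsym_in_rename V s (a : atom sg V) : fsym_in s (ren a) <-> fsym_in s a.
Proof. by rewrite /rename_atom; case: asboolP. Qed.

(** Renaming changes only predicate symbols, and [ext_rule] keeps all atoms of its rule. Hence [P]
    and its extension have the same Herbrand universe. *)
Lemma fsyms_ext s : fsyms P s <-> fsyms (ext base Q P) s.
Proof.
split=> [[r [a [Pr ra sa]]] | [_ [a [[[r Pr <-] | [_ [r [b [Pr rb ->]]] <-]]]]]].
- exists (ext_rule base Q r), a; split=> //; first by left; exists r.
  by move: ra; rewrite /atoms_of /= !List.in_app_iff; tauto.
- rewrite /atoms_of /= !List.in_app_iff => ra sa.
  have [ra'|ra'] : List.In a (headconj base Q r) \/ List.In a (atoms_of r).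
  + by rewrite /atoms_of !List.in_app_iff; tauto.
  + move/List.in_map_iff: ra' => [c [def_a rc]]; exists r, c; split=> //.
      by rewrite /atoms_of List.in_app_iff; left.
    by apply/fsym_in_rename; rewrite def_a.
  + by exists r, a.
- rewrite /atoms_of /= cats0 => /(List.in_map_iff _ (b :: _)) [c [<- rc]] sc.
  exists r, c; split=> //; last exact/fsym_in_rename.
  rewrite /atoms_of !List.in_app_iff.
  by case: rc => [<- | rc]; [left | right; left].
Qed.

Lemma ground_extE g : ground (ext base Q P) g <->
  exists2 h, ground P h &
    g = Rule (head h) (map ren (head h) ++ pbody h) (nbody h) \/
    exists2 a, List.In a (head h) & g = Rule [:: ren a] (map ren (pbody h)) [::].
Proof.
have HU1 := herbrand_universe_mono fsyms_ext.
have HU2 := herbrand_universe_mono (fun s => iff_sym (fsyms_ext s)).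
split=> [[_ [s [[[r Pr <-] | [_ [r [a [Pr ra ->]]] <-] ] HUs ->]]] |].
- exists (subst_rule s r); first by exists r, s; split=> // x; apply: HU2.
  by left; rewrite /subst_rule /= map_rename_subst map_cat.
- exists (subst_rule s r); first by exists r, s; split=> // x; apply: HU2.
  right; exists (subst_atom s a); first exact: List.in_map.
  by rewrite /subst_rule /= map_rename_subst rename_subst.
- move=> [_ [r [s [Pr HUs ->]]] [-> | ]].
    exists (ext_rule base Q r), s; split=> [|x|]; first by left; exists r.
      exact: HU1.
    by rewrite /subst_rule /= map_rename_subst map_cat.
  move=> [_ /List.in_map_iff [a [<- ra]] ->].
  exists (rename_rule base Q (Rule [:: a] (pbody r) [::])), s.
  split=> [|x|]; last by rewrite /subst_rule /= map_rename_subst rename_subst.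
    by right; exists (Rule [:: a] (pbody r) [::]) => //; exists r, a.
  exact: HU1.
Qed.

(** The two conjuncts treat the rules [ext_rule] and those of [ST]; the latter have no negation, so
    [J] is absent there. *)
Lemma model_ext J K : model (reduct (ground (ext base Q P)) J) K <->
  (forall h, ground P h -> (forall a, List.In a (head h) -> K (ren a)) ->
     (forall a, List.In a (pbody h) -> K a) ->
     (forall a, List.In a (nbody h) -> ~ J a) ->
     exists2 a, List.In a (head h) & K a) /\
  (forall h a, ground P h -> List.In a (head h) ->
     (forall b, List.In b (pbody h) -> K (ren b)) -> K (ren a)).
Proof.
split=> [/model_reduct mK | [mK1 mK2]].
  split=> [h Ph hK hp hn | h a Ph ha hp].
  - apply: (mK (Rule (head h) (map ren (head h) ++ pbody h) (nbody h))) => //.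
      by apply/ground_extE; exists h => //; left.
    by move=> a /List.in_app_iff [/List.in_map_iff [b [<- /hK]] | /hp].
  - have [] := mK (Rule [:: ren a] (map ren (pbody h)) [::]) => //.
    + by apply/ground_extE; exists h => //; right; exists a.
    + by move=> _ /List.in_map_iff [b [<- /hp]].
    + by move=> b [<-|].
apply/model_reduct => _ /ground_extE [h Ph [-> | [a ha ->]]] /= hp hn.
- apply: mK1 => // a ha; apply: hp; apply/List.in_app_iff; last by right.
  by left; apply: List.in_map.
- exists (ren a); first by left.
  by apply: mK2 Ph ha _ => b hb; apply: hp; apply: List.in_map.
Qed.

Lemma model_ext_derivable J K :
  model (reduct (ground (ext base Q P)) J) K -> ren @` L `<=` K.
Proof.
move=> /model_ext [_ mK] _ [a + <-].
by elim=> {a} h a Ph ha _ IH; apply: mK Ph ha IH.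
Qed.

Lemma model_ext_setI_derivable J K :
  model (reduct (ground (ext base Q P)) J) K ->
  model (reduct (ground P) J) (K `&` L).
Proof.
move=> mK; have renL := model_ext_derivable mK.
have [mK1 _] := (model_ext _ _).1 mK.
apply/model_reduct => h Ph hp hn.
have hL a : List.In a (head h) -> L a.
  by move=> ha; apply: (Derivable Ph ha) => b /hp[].
have [|b /hp[]|a ha Ka] := mK1 h Ph _ _ hn; last by exists a; [|split; auto].
(* The head atoms are derivable, so [K] contains their copies: this is [headconj]. *)
- by move=> a /hL La; apply: renL; exists a.
- by [].
Qed.

(** * Freshness of the copies and lifting of models *)

Hypotheses (facts : base_defined_by_facts base P).
Hypothesis fresh : fresh_renaming base Q P.

Lemma rename_preds (a : gatom sg) :
  preds P (pred_of a) -> preds P (pred_of (ren a)) -> base (pred_of a).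
Proof.
move=> Pa; apply: contraPP => nba; rewrite rename_derived //.
exact: (fresh.1 _ _ Pa nba).
Qed.

Lemma rename_inj (a b : gatom sg) :
  preds P (pred_of a) -> preds P (pred_of b) -> ren a = ren b -> a = b.
Proof.
move=> Pa Pb eq_ab.
have [ba | nba] := pselect (base (pred_of a)).
  have bb : base (pred_of b).
    by apply: rename_preds; rewrite // -eq_ab rename_base.
  by rewrite !rename_base in eq_ab.
have [bb | nbb] := pselect (base (pred_of b)).
  by case: nba; apply: rename_preds; rewrite // eq_ab rename_base.
move: eq_ab; rewrite !rename_derived //.
case: a Pa nba => n p u Pa nba; case: b Pb nbb => m q v Pb nbb /= eq_ab.
have eq_nm : n = m by case: eq_ab.
case: m / eq_nm q v Pb nbb eq_ab => q v Pb nbb [eqQ eqv].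
(* Symbols and arguments depend on the arity, so only equalities of dependent pairs are available;
   decidable equality on [nat] lets them be projected. *)
have inj := Eqdep_dec.inj_pair2_eq_dec _ PeanoNat.Nat.eq_dec.
rewrite (inj _ _ _ _ eqv) (fresh.2 _ p q) //; exact: inj eqQ.
Qed.

Definition lift N : set (gatom sg) := N `|` ren @` L.

Section Lift.
Variable N : set (gatom sg).
Hypotheses (NL : N `<=` L) (bN : forall a, base (pred_of a) -> L a -> N a).

(** The copy of L can meet the predicates of [P], since base atoms are their own copies. By
    freshness these are the only such atoms, and [bN] puts them in [N]. *)
Lemma lift_preds a : preds P (pred_of a) -> lift N a -> N a.
Proof.
move=> Pa [// | [b Lb def_a]]; have Pb := derivable_preds Lb.
have bb : base (pred_of b) by apply: rename_preds; rewrite ?def_a.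
by rewrite -def_a rename_base //; apply: bN.
Qed.

(** If [ren a] comes from the copy of L, injectivity applies; if it comes from [N], freshness makes
    [a] a base atom, so [ren a] is [a]. *)
Lemma lift_rename a : preds P (pred_of a) -> lift N (ren a) -> L a.
Proof.
move=> Pa [Na | [b Lb /rename_inj <- //]]; last exact: derivable_preds Lb.
have ba : base (pred_of a).
  by apply: rename_preds => //; apply: derivable_preds; apply: NL.
by apply: NL; rewrite rename_base in Na.
Qed.

Lemma restrict_lift : restrict_preds (lift N) (preds P) = N.
Proof.
apply/seteqP; split=> [a [lNa Pa]|a Na]; first exact: lift_preds.
by split; [left | apply: derivable_preds; apply: NL].
Qed.

Lemma model_lift I J : (forall a, preds P (pred_of a) -> I a <-> J a) ->
  model (reduct (ground P) I) N ->
  model (reduct (ground (ext base Q P)) J) (lift N).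
Proof.
move=> IJ /model_reduct mN; apply/model_ext; split=> h.
(* The premise [headconj] is discarded: the original body already yields a head atom in [N]. *)
- move=> Ph _ hp hn; have [] := mN h Ph.
  + by move=> a ha; apply: lift_preds (hp a ha); apply: (ground_pbody_preds Ph).
  + move=> a ha; rewrite IJ; first exact: hn.
    exact: (ground_nbody_preds Ph).
  + by move=> a ha Na; exists a => //; left.
- move=> a Ph ha hp; right; exists a => //; apply: (Derivable Ph ha) => b hb.
  by apply: lift_rename (hp b hb); apply: (ground_pbody_preds Ph).
Qed.

End Lift.

(** * Correspondence of stable models *)

Lemma lift_agree N : N `<=` L -> (forall a, base (pred_of a) -> L a -> N a) ->
  forall a, preds P (pred_of a) -> N a <-> lift N a.
Proof. by move=> NL bN a Pa; split=> [Na | /lift_preds]; [left | auto]. Qed.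

(** For a model [N] below [lift M], the part of [N] in L is a model below [M], hence equals [M]; as
    [N] also contains the copy of L, it is all of [lift M]. *)
Lemma SM_lift M : SM P M -> SM (ext base Q P) (lift M).
Proof.
move=> SMM; have [mM minM] := SMM; have ML := SM_derivable SMM.
have bM a := @derivable_base _ _ _ _ _ a facts mM.
have agree := lift_agree ML bM.
split=> [|N NM mN]; first exact: model_lift mM.
have mNL : model (reduct (ground P) M) (N `&` L).
  move/model_reduct: (model_ext_setI_derivable mN) => mNL.
  apply/model_reduct => g Pg gp gn; apply: mNL => // a ga lMa.
  by apply: (gn a ga); apply/(agree a (ground_nbody_preds Pg ga)).
have def_M : N `&` L = M.
  apply: minM => // a [/NM lMa La]; apply: lift_preds lMa => //.
  exact: derivable_preds.
apply/seteqP; split=> // a [Ma | ]; last exact: model_ext_derivable mN _.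
by move: Ma; rewrite -def_M => -[].
Qed.

(** Minimality of [M] is used twice: it identifies [M] with the lift of its part in L, and then with
    the lift of any smaller model [N]. Restriction to [preds P] undoes lifting, so [N] equals that
    part. *)
Lemma SM_ext M : SM (ext base Q P) M -> SM P (M `&` L) /\ M = lift (M `&` L).
Proof.
move=> [mM minM]; set K := M `&` L; have KL : K `<=` L by move=> a [].
have mK := model_ext_setI_derivable mM; rewrite -/K in mK.
have bK a := @derivable_base _ _ _ _ _ a facts mK.
have def_M : lift K = M.
  apply: minM => [a [[] // | ]|]; first exact: model_ext_derivable mM _.
  exact: model_lift mK.
have agree a : preds P (pred_of a) -> K a <-> M a.
  by move=> Pa; rewrite -def_M; apply: lift_agree.
split=> //; split.
  apply/model_reduct => g Pg gp gn; move/model_reduct: mK; apply=> // a ga.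
  by rewrite -agree; [apply: gn | apply: (ground_nbody_preds Pg)].
move=> N NK mN; have NL : N `<=` L by move=> a /NK /KL.
have bN a := @derivable_base _ _ _ _ _ a facts mN.
rewrite -(restrict_lift NL bN) -(restrict_lift KL bK) def_M; congr restrict_preds.
apply: minM; last exact: (model_lift NL bN agree).
by rewrite -def_M => a [/NK|]; [left | right].
Qed.

End Extension.

Theorem theorem5 (sg : signature) (P : set (prule sg)) (base : set (pname sg))
    (Q : forall n : nat, psym sg n -> psym sg n) :
  is_program P ->
  range_restricted P ->
  base_defined_by_facts base P ->
  fresh_renaming base Q P ->
  [set restrict_preds M (preds P) | M in SM P] =
  [set restrict_preds M (preds P) | M in SM (ext base Q P)].
Proof.
move=> _ _ facts fresh.
have restrictE M : SM P M ->
    restrict_preds (lift P base Q M) (preds P) = restrict_preds M (preds P).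
  move=> SMM; have ML := SM_derivable SMM.
  rewrite restrict_lift //; last by move=> a; apply: derivable_base SMM.1.
  by rewrite restrict_preds_id // => a /ML /derivable_preds.
apply/seteqP; split=> _ [M SMM <-].
  by exists (lift P base Q M); [apply: SM_lift | apply: restrictE].
have [SMK def_M] := SM_ext facts fresh SMM.
by exists (M `&` derivable P) => //; rewrite [in RHS]def_M restrictE.
Qed.
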